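(* Let $\mathbf{M}=S^{s-1}=\{x\in\mathbf{R}^s:\|x\|=1\}$, whose cutlocus is $\mathbf{C}=\{0\}$ and nearest-point map is $\pi(t)=t/\|t\|$ ($t\neq0$); here $m=s-1$. Let $(t_n)$ in $\mathbf{R}^s$, random vectors $\tilde t_n$ in $\mathbf{R}^s$, and nonsingular $s\times s$ matrices $B_n\to0$ with $Z_n=B_n^{-1}(\tilde t_n-t_n)\xrightarrow{\mathcal D}Z$. Assume $t_n\neq0$, $d(t_n,\mathbf{M})\le D$ for all $n$, and $\|B_n\|/\|t_n\|\to0$. Put $\mu_n=\pi(t_n)$, $\tilde\mu_n=\pi(\tilde t_n)$ and $$G_n=\|t_n\|\tan_{\mu_n}+\varepsilon_n(\mathrm{I}_s-\tan_{\mu_n}),$$ where $\varepsilon_n=O(\|t_n\|)$ (in particular one may take $\varepsilon_n=\|t_n\|$, giving $G_n=\|t_n\|\mathrm{I}_s$). Let $\Gamma_n$ be $s\times s$ matrices with $$\|\Gamma_n\|\,\|B_n\|^2/\|t_n\|\to0.$$ Then: (1) $\Gamma_nG_n(\tilde\mu_n-\mu_n)-(\Gamma_n\tan_{\mu_n}B_n)Z_n\to0$ in probability. If moreover $Z$ is spherical and $\Gamma_n\tan_{\mu_n}B_nB_n^T\tan_{\mu_n}\Gamma_n^T=\tan_{\mu_n}$ for all $n$, then (2) if $\mu_n\to\mu\in\mathbf{M}$, $\Gamma_nG_n(\tilde\mu_n-\mu_n)=(\Gamma_n\tan_{\mu_n}B_n)Z_n+o_P(1)\xrightarrow{\mathcal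 D}\tan_\mu Z$; and (3) $(\tilde\mu_n-\mu_n)^TG_n\Gamma_n^T\Gamma_nG_n(\tilde\mu_n-\mu_n)\xrightarrow{\mathcal D}\zeta_{s-1}^2$.
   Context: $\|\cdot\|$: Euclidean norm / operator norm; $d(t,\mathbf{M})=\inf_{x\in\mathbf{M}}\|t-x\|$. For $\mu\in S^{s-1}$, $\tan_\mu=\mathrm{I}_s-\mu\mu^T$ is the orthogonal projection onto the tangent space $T_\mu S^{s-1}=\mu^\perp$. $Z$ spherical: $HZ\overset{\mathcal D}{=}Z$ for all orthogonal $s\times s$ matrices $H$; $\zeta_{m}^2$ is the distribution of $\sum_{i=1}^{m}Z_i^2$ for $Z=(Z_1,\dots,Z_s)$. $o_P(1)$: term tending to $0$ in probability. *)

(* Defs.v *)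
From HB Require Import structures.
From mathcomp Require Import all_boot all_order all_algebra.
From mathcomp Require Import all_classical all_reals all_analysis.
Set Implicit Arguments. Unset Strict Implicit. Unset Printing Implicit Defensive.
Import Order.TTheory GRing.Theory Num.Theory.
Import numFieldNormedType.Exports.
Local Open Scope classical_set_scope.
Local Open Scope ring_scope.

Definition enorm (R : realType) (s : nat) (v : 'cV[R]_s) : R :=
  Num.sqrt (\sum_(i < s) (v i 0) ^+ 2).

Definition opnorm (R : realType) (s : nat) (A : 'M[R]_s) : R :=
  sup [set enorm (A *m v) | v in [set v : 'cV[R]_s | enorm v = 1]].

Definition sphere (R : realType) (s : nat) : set 'cV[R]_s :=
  [set x | enorm x = 1].

Definition dist_set (R : realType) (s : nat) (t : 'cV[R]_s) (M : set 'cV[R]_s) : R :=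
  inf [set enorm (t - x) | x in M].

(* nearest-point map pi(t) = t / ||t|| (for t <> 0; at the cut locus 0 it
   returns 0, an arbitrary convention) *)
Definition proj_sph (R : realType) (s : nat) (t : 'cV[R]_s) : 'cV[R]_s :=
  (enorm t)^-1 *: t.

Definition tanp (R : realType) (s : nat) (mu : 'cV[R]_s) : 'M[R]_s :=
  1%:M - mu *m mu^T.

Definition bounded_fun (V : Type) (R : realType) (f : V -> R) : Prop :=
  exists M : R, forall x, `|f x| <= M.

Definition cvg_dist (R : realType) (V : topologicalType)
  (d : measure_display) (T : measurableType d) (P : probability T R)
  (X : nat -> T -> V)
  (d' : measure_display) (T' : measurableType d') (P' : probability T' R)
  (Y : T' -> V) : Prop :=
  forall f : V -> R, continuous f -> bounded_fun f ->
    (fun n => Rintegral P setT (fun w => f (X n w))) @ \oo -->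
      Rintegral P' setT (fun w => f (Y w)).

Definition cvg_prob0 (R : realType) (s : nat)
  (d : measure_display) (T : measurableType d) (P : probability T R)
  (Y : nat -> T -> 'cV[R]_s) : Prop :=
  forall e : R, 0 < e ->
    (fun n => fine (P [set w | e < enorm (Y n w)])) @ \oo --> (0 : R).

Definition eq_dist (R : realType) (V : topologicalType)
  (d : measure_display) (T : measurableType d) (P : probability T R)
  (X Y : T -> V) : Prop :=
  forall f : V -> R, continuous f -> bounded_fun f ->
    Rintegral P setT (fun w => f (X w)) = Rintegral P setT (fun w => f (Y w)).

Definition spherical (R : realType) (s : nat)
  (d : measure_display) (T : measurableType d) (P : probability T R)
  (Z : T -> 'cV[R]_s) : Prop :=
  forall H : 'M[R]_s, H^T *m H = 1%:M ->
    eq_dist P (fun w => H *m Z w) Z.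

(* Main.v *)
Require Import Defs.
From HB Require Import structures.
From mathcomp Require Import all_boot all_order all_algebra.
From mathcomp Require Import all_classical all_reals all_analysis.
From mathcomp Require Import measurable_realfun ring lra.
Import Order.TTheory GRing.Theory Num.Theory.
Import numFieldNormedType.Exports.
Local Open Scope classical_set_scope.
Local Open Scope ring_scope.
Set Implicit Arguments. Unset Strict Implicit. Unset Printing Implicit Defensive.

(** With [mu = t / |t|], the projection [pi] is homogeneous of degree 0 and
[pi (mu + v) = mu + tan_mu v + O(|v|^2)] uniformly in [v]. Taking
[v = B Z / |t|], the error in (1) is at most a constant times
[|Gam| |B|^2 / |t| * |Z|^2], a null sequence times a tight one.

For (2) and (3), [A = Gam tan_mu B] satisfies [A A^T = tan_mu]. Since [A_n]
need not converge, limits are taken along ultrafilters, where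
[A_n -> A] and [mu_n -> mu] with [A A^T = tan_mu] again. Such an [A] equals
[tan_mu H] with [H] orthogonal, so [A Z] has the law of [tan_mu Z], and a
reflection carrying [mu] to the last basis vector identifies the law of
[|tan_mu Z|^2]. *)

(** * Euclidean norm and the projection onto the sphere *)

(** The vector [v] is random and unbounded, and [tt n] may hit the centre 0. An expansion valid only
    for small [v] would need a separate estimate on a bad event, so the quadratic bound is proved
    for every [v], with the value [proj_sph 0 = 0] included. The matrix [G] does not disturb the
    leading term, which is tangent: there [G] is multiplication by [enorm t]. The number [eps]
    reaches only the remainder, where [G] is still of order [enorm t] and cancels one of the two
    factors [(enorm t)^-1] coming from the square of [v].

    Convergence in distribution concerns one real sequence per test function, so it can be checked
    along each ultrafilter finer than [\oo]. Different ultrafilters may produce different limits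
    [A]; the answer is unique because, for spherical [Z], the law of [A Z] depends on [A] only
    through [A A^T = tan_mu]. In (3) even [mu] varies with the ultrafilter, and only the squared
    length has a law independent of it. *)

Definition dotc (R : realType) (s : nat) (u v : 'cV[R]_s) : R :=
  \sum_(i < s) u i 0 * v i 0.

Lemma dotcC (R : realType) (s : nat) (u v : 'cV[R]_s) : dotc u v = dotc v u.
Proof. by apply: eq_bigr => i _; rewrite mulrC. Qed.

Lemma dotcDr (R : realType) (s : nat) (u v w : 'cV[R]_s) :
  dotc u (v + w) = dotc u v + dotc u w.
Proof. by rewrite -big_split; apply: eq_bigr => i _; rewrite !mxE mulrDr. Qed.

Lemma dotcZr (R : realType) (s : nat) (a : R) (u v : 'cV[R]_s) :
  dotc u (a *: v) = a * dotc u v.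
Proof. by rewrite mulr_sumr; apply: eq_bigr => i _; rewrite !mxE mulrCA. Qed.

Lemma dotcDl (R : realType) (s : nat) (u v w : 'cV[R]_s) :
  dotc (v + w) u = dotc v u + dotc w u.
Proof. by rewrite dotcC dotcDr !(dotcC u). Qed.

Lemma dotcZl (R : realType) (s : nat) (a : R) (u v : 'cV[R]_s) :
  dotc (a *: u) v = a * dotc u v.
Proof. by rewrite dotcC dotcZr dotcC. Qed.

Lemma dotcE (R : realType) (s : nat) (u v : 'cV[R]_s) :
  dotc u v = (u^T *m v) 0 0.
Proof. by rewrite mxE; apply: eq_bigr => i _; rewrite mxE. Qed.

Lemma mulmx_trl (R : realType) (s : nat) (u v : 'cV[R]_s) :
  u^T *m v = (dotc u v)%:M.
Proof. by apply/matrixP => i j; rewrite !ord1 -dotcE [RHS]mxE eqxx mulr1n. Qed.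

Lemma dotc_mulmxl (R : realType) (s : nat) (A : 'M[R]_s) (u v : 'cV[R]_s) :
  dotc (A *m u) v = dotc u (A^T *m v).
Proof. by rewrite !dotcE trmx_mul mulmxA. Qed.

Lemma dotcvv (R : realType) (s : nat) (v : 'cV[R]_s) :
  dotc v v = \sum_(i < s) (v i 0) ^+ 2.
Proof. by apply: eq_bigr => i _; rewrite expr2. Qed.

Lemma dotcvv_ge0 (R : realType) (s : nat) (v : 'cV[R]_s) : 0 <= dotc v v.
Proof. by rewrite dotcvv; apply: sumr_ge0 => i _; exact: sqr_ge0. Qed.

Lemma enorm_ge0 (R : realType) (s : nat) (v : 'cV[R]_s) : 0 <= enorm v.
Proof. exact: sqrtr_ge0. Qed.

Lemma sqr_enorm (R : realType) (s : nat) (v : 'cV[R]_s) :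
  enorm v ^+ 2 = dotc v v.
Proof. by rewrite /enorm sqr_sqrtr -dotcvv ?dotcvv_ge0. Qed.

Lemma enormE (R : realType) (s : nat) (v : 'cV[R]_s) :
  enorm v = Num.sqrt (dotc v v).
Proof. by rewrite dotcvv. Qed.

Lemma enormZ (R : realType) (s : nat) (a : R) (v : 'cV[R]_s) :
  enorm (a *: v) = `|a| * enorm v.
Proof.
by rewrite !enormE dotcZl dotcZr mulrA -expr2 sqrtrM ?sqr_ge0// sqrtr_sqr.
Qed.

Lemma enormN (R : realType) (s : nat) (v : 'cV[R]_s) : enorm (- v) = enorm v.
Proof. by rewrite -scaleN1r enormZ normrN1 mul1r. Qed.

Lemma coord_le_enorm (R : realType) (s : nat) (v : 'cV[R]_s) (i : 'I_s) :
  `|v i 0| <= enorm v.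
Proof.
rewrite -sqrtr_sqr ler_wsqrtr// (bigD1 i)//= lerDl.
by apply: sumr_ge0 => j _; exact: sqr_ge0.
Qed.

Lemma enorm_eq0 (R : realType) (s : nat) (v : 'cV[R]_s) :
  (enorm v == 0) = (v == 0).
Proof.
apply/eqP/eqP => [v0|->]; last by rewrite -(scale0r 0) enormZ normr0 mul0r.
apply/matrixP => i j; rewrite ord1 mxE; apply/eqP.
by rewrite -normr_le0 -v0 coord_le_enorm.
Qed.

Lemma enorm_gt0 (R : realType) (s : nat) (v : 'cV[R]_s) :
  (0 < enorm v) = (v != 0).
Proof. by rewrite lt_def enorm_ge0 andbT enorm_eq0. Qed.

Lemma cauchy_schwarz (R : realType) (s : nat) (u v : 'cV[R]_s) :
  `|dotc u v| <= enorm u * enorm v.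
Proof.
wlog suff H : u v / dotc u v <= enorm u * enorm v.
  have [_|_] := ger0P (dotc u v); first exact: H.
  by have := H (- u) v; rewrite enormN -scaleN1r dotcZl mulN1r.
have [->|u0] := eqVneq u 0.
  by rewrite -(scale0r 0) dotcZl mul0r mulr_ge0 ?enorm_ge0.
have [->|v0] := eqVneq v 0.
  by rewrite -(scale0r 0) dotcZr mul0r mulr_ge0 ?enorm_ge0.
(* With [a], [b], [c] as set below, this square expands to [2 * (a * b) * (a * b - c)]. *)
have := dotcvv_ge0 (enorm v *: u - enorm u *: v).
rewrite -scaleNr !dotcDl !dotcDr !dotcZl !dotcZr -!sqr_enorm (dotcC v u).
move: u0 v0; rewrite -!enorm_gt0.
set a := enorm u; set b := enorm v; set c := dotc u v => a0 b0 h.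
have : 0 <= (a * b) * (a * b - c) by lra.
by rewrite pmulr_rge0 ?mulr_gt0// subr_ge0.
Qed.

Lemma enormD (R : realType) (s : nat) (u v : 'cV[R]_s) :
  enorm (u + v) <= enorm u + enorm v.
Proof.
rewrite -ler_sqr ?nnegrE ?addr_ge0 ?enorm_ge0//.
rewrite sqr_enorm !dotcDl !dotcDr -!sqr_enorm (dotcC v u).
have := cauchy_schwarz u v; rewrite ler_norml => /andP[_]; lra.
Qed.

Lemma enormB (R : realType) (s : nat) (u v : 'cV[R]_s) :
  enorm (u - v) <= enorm u + enorm v.
Proof. by rewrite (le_trans (enormD _ _))// enormN. Qed.

Lemma enorm_dist (R : realType) (s : nat) (u v : 'cV[R]_s) :
  `|enorm u - enorm v| <= enorm (u - v).
Proof.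
have h1 := enormD (u - v) v; have h2 := enormD (v - u) u.
rewrite !subrK -(enormN (v - u)) opprB in h1 h2.
by rewrite ler_norml; apply/andP; split; lra.
Qed.

Lemma enorm_le_sum (R : realType) (s : nat) (v : 'cV[R]_s) :
  enorm v <= \sum_(i < s) `|v i 0|.
Proof.
rewrite -ler_sqr ?nnegrE ?enorm_ge0 ?sumr_ge0// sqr_enorm expr2 mulr_suml.
apply: ler_sum => i _; apply: (le_trans (ler_norm _)).
rewrite normrM ler_wpM2l// (bigD1 i)//= lerDl.
by apply: sumr_ge0.
Qed.

(** The entrywise l1 norm dominates the operator norm and is visibly continuous in the entries. It
    shows that the supremum in [opnorm] is finite and turns entrywise convergence of matrices into a
    bound on vectors. *)
Definition fnorm (R : realType) (s : nat) (A : 'M[R]_s) : R :=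
  \sum_(i < s) \sum_(j < s) `|A i j|.

Lemma enorm_mulmx_fnorm (R : realType) (s : nat) (A : 'M[R]_s) (v : 'cV[R]_s) :
  enorm (A *m v) <= fnorm A * enorm v.
Proof.
apply: (le_trans (enorm_le_sum _)); rewrite mulr_suml.
apply: ler_sum => i _; rewrite mxE mulr_suml.
apply: (le_trans (ler_norm_sum _ _ _)); apply: ler_sum => j _.
by rewrite normrM ler_wpM2l// coord_le_enorm.
Qed.

Lemma opnorm_has_sup (R : realType) (s : nat) (A : 'M[R]_s) (v : 'cV[R]_s) :
  enorm v = 1 ->
  has_sup [set enorm (A *m v) | v in [set v : 'cV[R]_s | enorm v = 1]].
Proof.
move=> v1; split; first by exists (enorm (A *m v)), v.
exists (fnorm A) => _ [w /= w1 <-].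
by rewrite -[leRHS]mulr1 -w1 enorm_mulmx_fnorm.
Qed.

Lemma enorm_mulmx (R : realType) (s : nat) (A : 'M[R]_s) (v : 'cV[R]_s) :
  enorm (A *m v) <= opnorm A * enorm v.
Proof.
have [->|v0] := eqVneq v 0; first by rewrite mulmx0 (eqP (_ : enorm 0 == 0))
  ?mulr0// enorm_eq0.
have e0 : 0 < enorm v by rewrite enorm_gt0.
have [w w1 vw] : exists2 w, enorm w = 1 & v = enorm v *: w.
  exists ((enorm v)^-1 *: v); last by rewrite scalerA divff ?gt_eqF// scale1r.
  by rewrite enormZ gtr0_norm ?invr_gt0// mulVf ?gt_eqF.
rewrite {1}vw -scalemxAr enormZ ger0_norm ?enorm_ge0// mulrC.
rewrite ler_wpM2r ?enorm_ge0//; apply: sup_ubound; last by exists w.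
by have [] := opnorm_has_sup A w1.
Qed.

Lemma opnorm_ge0 (R : realType) (s : nat) (A : 'M[R]_s) (v : 'cV[R]_s) :
  v != 0 -> 0 <= opnorm A.
Proof.
rewrite -enorm_gt0 => v0; rewrite -(pmulr_lge0 _ v0).
exact: le_trans (enorm_ge0 _) (enorm_mulmx _ _).
Qed.

Lemma tanp_mulmx (R : realType) (s : nat) (mu v : 'cV[R]_s) :
  tanp mu *m v = v - dotc mu v *: mu.
Proof.
by rewrite mulmxBl mul1mx -mulmxA mulmx_trl mul_mx_scalar.
Qed.

Lemma trmx_tanp (R : realType) (s : nat) (mu : 'cV[R]_s) :
  (tanp mu)^T = tanp mu.
Proof. by rewrite /tanp linearB/= trmx1 trmx_mul trmxK. Qed.

Lemma tanp_self (R : realType) (s : nat) (mu : 'cV[R]_s) :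
  enorm mu = 1 -> tanp mu *m mu = 0.
Proof. by move=> mu1; rewrite tanp_mulmx -sqr_enorm mu1 expr1n scale1r subrr. Qed.

Lemma tanp_idem (R : realType) (s : nat) (mu : 'cV[R]_s) :
  enorm mu = 1 -> tanp mu *m tanp mu = tanp mu.
Proof.
by move=> mu1; rewrite {2}/tanp mulmxBr mulmx1 mulmxA tanp_self// mul0mx subr0.
Qed.

Lemma enorm_proj_sph (R : realType) (s : nat) (u : 'cV[R]_s) :
  u != 0 -> enorm (proj_sph u) = 1.
Proof.
by move=> u0; rewrite enormZ ger0_norm ?invr_ge0 ?enorm_ge0// mulVf// enorm_eq0.
Qed.

Lemma proj_sphZ (R : realType) (s : nat) (a : R) (u : 'cV[R]_s) :
  0 < a -> proj_sph (a *: u) = proj_sph u.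
Proof.
move=> a0; rewrite /proj_sph enormZ gtr0_norm// scalerA invfM mulrAC.
by rewrite mulVf ?mul1r// gt_eqF.
Qed.

Lemma proj_sph_expansion (R : realType) (s : nat) (mu v : 'cV[R]_s) :
  enorm mu = 1 ->
  enorm (proj_sph (mu + v) - mu - tanp mu *m v) <= 12 * enorm v ^+ 2.
Proof.
move=> mu1; rewrite tanp_mulmx.
have dmu : dotc mu mu = 1 by rewrite -sqr_enorm mu1 expr1n.
have av : `|dotc mu v| <= enorm v.
  by rewrite (le_trans (cauchy_schwarz _ _))// mu1 mul1r.
have r2 : enorm (mu + v) ^+ 2 = 1 + 2 * dotc mu v + enorm v ^+ 2.
  by rewrite sqr_enorm !dotcDl !dotcDr dmu -sqr_enorm (dotcC v mu); ring.
have rd : `|enorm (mu + v) - 1| <= enorm v.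
  by rewrite -mu1 (le_trans (enorm_dist _ _))// addrC addKr.
have d0 := enorm_ge0 v; have r0 := enorm_ge0 (mu + v).
(* For [d = enorm v >= 1 / 2] the triangle inequality gives [2 + 2 * d], which equals [12 * d ^+ 2]
   at [d = 1 / 2]: this fixes the constant 12. The near case only needs 5. *)
have [dh|dh] := leP (1 / 2) (enorm v).
  have p1 : enorm (proj_sph (mu + v)) <= 1.
    have [->|/enorm_proj_sph->//] := eqVneq (mu + v) 0.
    by rewrite /proj_sph scaler0 (eqP (_ : enorm 0 == 0)) ?enorm_eq0.
  have h1 := enormB (proj_sph (mu + v) - mu) (v - dotc mu v *: mu).
  have h2 := enormB (proj_sph (mu + v)) mu.
  have h3 := enormB v (dotc mu v *: mu).
  rewrite enormZ mu1 mulr1 in h3; rewrite mu1 in h2.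
  have h4 : 0 <= (enorm v - 1 / 2) * (enorm v + 2) by rewrite mulr_ge0; lra.
  by rewrite expr2; nra.
have -> : proj_sph (mu + v) - mu - (v - dotc mu v *: mu) =
    ((enorm (mu + v))^-1 - 1 + dotc mu v) *: mu + ((enorm (mu + v))^-1 - 1) *: v.
  by apply/matrixP => i j; rewrite !mxE; ring.
apply: (le_trans (enormD _ _)); rewrite !enormZ mu1 mulr1.
move: av r2 rd d0 r0 dh.
set r := enorm (mu + v); set d := enorm v; set a := dotc mu v.
rewrite !ler_norml => /andP[a1 a2] r2 /andP[rd1 rd2] d0 r0 dh.
have rh : 1 / 2 <= r by lra.
have rp : 0 < r by lra.
have q : `|r^-1 - 1| * r <= d.
  rewrite -{2}(gtr0_norm rp) -normrM mulrBl mulVf ?gt_eqF// mul1r.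
  by rewrite ler_norml; apply/andP; split; lra.
have p : `|r^-1 - 1 + a| * r <= 3 / 2 * d ^+ 2.
  rewrite -{2}(gtr0_norm rp) -normrM mulrDl mulrBl mulVf ?gt_eqF// mul1r.
  (* Since [r ^+ 2 = 1 + 2 * a + d ^+ 2], the first-order terms cancel and only products of two
     factors of size at most [d] remain. *)
  have -> : 1 - r + a * r = ((r - 1) ^+ 2 - d ^+ 2) / 2 + a * (r - 1).
    have -> : d ^+ 2 = r ^+ 2 - 1 - 2 * a by rewrite r2; ring.
    by field.
  have s1 : (r - 1) ^+ 2 <= d ^+ 2.
    rewrite -[leLHS]real_normK ?num_real// ler_sqr ?nnegrE//.
    by rewrite ler_norml rd1.
  have s2 : `|a * (r - 1)| <= d ^+ 2.
    by rewrite normrM expr2 ler_pM// ler_norml; apply/andP; split; lra.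
  move: s2; rewrite !ler_norml => /andP[s2 s3].
  by have := sqr_ge0 (r - 1); move=> ?; apply/andP; split; lra.
have q' : `|r^-1 - 1| <= 2 * d.
  by have := ler_wpM2l (normr_ge0 (r^-1 - 1)) rh; lra.
have p' : `|r^-1 - 1 + a| <= 3 * d ^+ 2.
  by have := ler_wpM2l (normr_ge0 (r^-1 - 1 + a)) rh; lra.
have := ler_wpM2r d0 q'; have := sqr_ge0 d; rewrite expr2; lra.
Qed.

(** * Continuity and measurability of vector-valued maps *)

(** A neighbourhood of a matrix contains a finite product of neighbourhoods of its entries. The
    filter is arbitrary, so that ultrafilters and neighbourhood filters are both covered. *)
Lemma cvg_mxP (R : realType) (I : Type) (F : set_system I) (FF : Filter F)
    (m n : nat) (X : I -> 'M[R]_(m, n)) (A : 'M[R]_(m, n)) :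
  (forall i j, X k i j @[k --> F] --> A i j) <-> (X @ F --> A).
Proof.
split=> [XA B [Q AQ QB]|XA i j]; last first.
  exact: (cvg_comp _ _ XA (@coord_continuous _ _ _ i j A)).
have : \forall k \near F, forall i j, Q i j (X k i j).
  apply: filter_forall => i; apply: filter_forall => j; exact: XA (AQ i j).
by apply: filterS => k Qk; exact: QB.
Qed.

Lemma continuous_mxP (R : realType) (V : topologicalType) (m n : nat)
    (f : V -> 'M[R]_(m, n)) :
  (forall i j, continuous (fun x => f x i j)) <-> continuous f.
Proof.
split=> [fc x|fc i j x]; first by apply/cvg_mxP => i j; exact: fc.
by move: i j; apply/cvg_mxP; exact: fc.
Qed.

Lemma continuous_mulmx (R : realType) (m n p : nat) (A : 'M[R]_(m, n)) :
  continuous (fun x : 'M[R]_(n, p) => A *m x).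
Proof.
apply/continuous_mxP => i j.
have -> : (fun x : 'M[R]_(n, p) => (A *m x) i j) =
    (fun x => \sum_k A i k * x k j) by apply/funext => x; rewrite mxE.
move=> x.
apply: (cvg_big add_continuous (nbhs_filter x)) => k _.
by apply: cvgM; [exact: cvg_cst|exact: coord_continuous].
Qed.

Lemma continuous_enorm (R : realType) (s : nat) : continuous (@enorm R s).
Proof.
move=> x; apply: continuous_comp; last exact: sqrt_continuous.
apply: (cvg_big add_continuous (nbhs_filter x)) => k _; rewrite expr2.
under eq_fun do rewrite expr2.
by apply: cvgM; exact: coord_continuous.
Qed.

(* An open set is the union of the rational boxes it contains. *)
Lemma measurable_fun_continuous_comp (R : realType) (s : nat)
    (d : measure_display) (T : measurableType d) (X : T -> 'cV[R]_s)
    (g : 'cV[R]_s -> R) :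
  (forall i, measurable_fun setT (fun w => X w i 0)) -> continuous g ->
  measurable_fun setT (fun w => g (X w)).
Proof.
move=> mX gc _.
apply: (measurability _ (RGenOInfty.measurableE R)) => //.
move=> /= _ [_ [a ->] <-]; rewrite setTI.
pose box (p : 'cV[rat]_s * rat) :=
  [set x : 'cV[R]_s | forall i, `|ratr (p.1 i 0) - x i 0| < ratr p.2].
pose F p := if `[< forall x, box p x -> a < g x >] then
  [set w | box p (X w)] else set0.
rewrite (_ : _ @^-1` _ = \bigcup_p F p); last first.
  apply/seteqP; split => [w|w [p _]]; rewrite /F; last first.
    case: asboolP => // bg /= bX; rewrite in_itv/= andbT; exact: bg.
  rewrite /= in_itv/= andbT => aw.
  have /nbhs_ballP[e /= e0 be] : \forall x \near X w, a < g x.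
    exact: (gc (X w) [set y | a < y]) (lt_nbhsr aw).
  (* A box of radius [r] whose centre is within [r] of [X w] stays within [2 * r < e] of [X w]. *)
  have [r] := rat_in_itvoo (divr_gt0 e0 (ltr0n R 2)); rewrite in_itv/= => /andP[r0 re].
  have /choice[q qX] (i : 'I_s) : exists q : rat, `|ratr q - X w i 0| < ratr r.
    have [q] := @rat_in_itvoo R (X w i 0 - ratr r) (X w i 0 + ratr r) ltac:(lra).
    by rewrite in_itv/= => /andP[? ?]; exists q; rewrite ltr_norml; apply/andP; split; lra.
  exists (\col_i q i, r) => //.
  case: asboolP => [_ i /=|]; first by rewrite mxE.
  case=> x bx; apply: be; split=> // i j; rewrite ord1 /ball/=.
  have := bx i; rewrite /= mxE => xi.
  have := qX i; move: xi; rewrite !ltr_norml => /andP[? ?] /andP[? ?].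
  by apply/andP; split; lra.
apply: countable_bigcupT_measurable => [|p]; first exact: countableP.
rewrite /F; case: asboolP => // _.
rewrite (_ : [set w | _] = \bigcap_(i in [set: 'I_s])
   [set w | `|ratr (p.1 i 0) - X w i 0| < ratr p.2]); last first.
  by apply/seteqP; split => [w + i _|w + i]; exact.
apply: fin_bigcap_measurable => // i _.
have -> : [set w | `|ratr (p.1 i 0) - X w i 0| < ratr p.2] =
  (fun w => X w i 0) @^-1` `]ratr (p.1 i 0) - ratr p.2, ratr (p.1 i 0) + ratr p.2[.
  apply/seteqP; split => w /=; rewrite in_itv/= ltr_norml => /andP[? ?];
    apply/andP; split; lra.
rewrite -[X in measurable X]setTI; exact: mX.
Qed.

(* [x^-1 = lim x / (x^2 + 1/n)], also at [x = 0] where [0^-1 = 0]. *)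
Lemma measurable_funV (R : realType) (d : measure_display) (T : measurableType d)
    (f : T -> R) :
  measurable_fun setT f -> measurable_fun setT (fun w => (f w)^-1).
Proof.
move=> mf; apply: (@measurable_fun_cvg _ _ _ _
  (fun n w => f w / ((f w) ^+ 2 + n.+1%:R^-1))).
  move=> n.
  have hc : continuous (fun x : R => x / (x ^+ 2 + n.+1%:R^-1)).
    move=> x; apply: cvgM => //; apply: cvgV.
      by rewrite gt_eqF// ltr_wpDl ?sqr_ge0// invr_gt0 ltr0n.
    by apply: cvgD; [exact: exprn_continuous|exact: cvg_cst].
  exact: measurableT_comp (continuous_measurable_fun hc) mf.
move=> w _; have [->|f0] := eqVneq (f w) 0.
  by rewrite invr0; under eq_fun do rewrite mul0r; exact: cvg_cst.
have -> : (f w)^-1 = f w / (f w ^+ 2 + 0).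
  by rewrite addr0 expr2 invfM mulrA divff// mul1r.
apply: cvgM; first exact: cvg_cst.
apply: cvgV; first by rewrite addr0 sqrf_eq0.
by apply: cvgD; [exact: cvg_cst|exact: cvg_harmonic].
Qed.

(** * Tightness *)

Lemma integrable_bounded (R : realType) (d : measure_display)
    (T : measurableType d) (P : probability T R) (h : T -> R) (M : R) :
  measurable_fun setT h -> (forall w, `|h w| <= M) ->
  P.-integrable setT (EFin \o h).
Proof.
move=> mh hM; apply: measurable_bounded_integrable => //.
  by apply: (le_lt_trans (probability_le1 P measurableT)); rewrite ltry.
by exists M; split; [exact: num_real|move=> x Mx w _ /=; rewrite (le_trans (hM w))// ltW].
Qed.

Lemma Rintegral_indic (R : realType) (d : measure_display)
    (T : measurableType d) (P : probability T R) (S : set T) :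
  measurable S -> Rintegral P setT \1_S = fine (P S).
Proof. by move=> mS; rewrite /Rintegral integral_indic// setIT. Qed.

(** The difference is dominated by [e + 2 * M * \1_S]: [S] is a bad event on which only the bound
    [M] is available. *)
Lemma Rintegral_close (R : realType) (d : measure_display)
    (T : measurableType d) (P : probability T R) (h1 h2 : T -> R) (M e : R)
    (S : set T) :
  measurable_fun setT h1 -> measurable_fun setT h2 ->
  (forall w, `|h1 w| <= M) -> (forall w, `|h2 w| <= M) -> 0 <= e ->
  measurable S -> (forall w, ~ S w -> `|h1 w - h2 w| <= e) ->
  `|Rintegral P setT h1 - Rintegral P setT h2| <= e + 2 * M * fine (P S).
Proof.
move=> m1 m2 b1 b2 e0 mS h12.
have i1 := integrable_bounded P m1 b1.
have i2 := integrable_bounded P m2 b2.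
have b12 w : `|h1 w - h2 w| <= M + M.
  by rewrite (le_trans (ler_normB _ _))// lerD.
have M0 : 0 <= M + M by rewrite (le_trans _ (b12 point)).
have m12 : measurable_fun setT (fun w => h1 w - h2 w) by exact: measurable_funB.
have iI : P.-integrable setT (EFin \o (fun w => (2 * M) * \1_S w)).
  apply: (@integrable_bounded _ _ _ _ _ (2 * M)).
    by apply: measurable_funM => //; exact: measurable_indic.
  by move=> w; rewrite normrM indicE; case: (_ \in _); rewrite ?normr1 ?normr0;
    rewrite ?mulr0 ?mulr1 ?ger0_norm; lra.
have ic : P.-integrable setT (EFin \o (fun w => e + (2 * M) * \1_S w)).
  apply: (@integrable_bounded _ _ _ _ _ (e + 2 * M)).
    by apply: measurable_funD => //; apply: measurable_funM => //; exact: measurable_indic.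
  by move=> w; rewrite indicE; case: (_ \in _); rewrite ?mulr0 ?mulr1 ger0_norm; lra.
rewrite -RintegralB//; apply: (le_trans (le_normr_Rintegral _ _)) => //.
  exact: integrable_bounded m12 b12.
have -> : e + 2 * M * fine (P S) =
    Rintegral P setT (fun w => e + (2 * M) * \1_S w).
  rewrite RintegralD//; last by apply: (@integrable_bounded _ _ _ _ _ e) => // w; rewrite ger0_norm.
  rewrite Rintegral_cst//.
  rewrite [X in e * X](_ : _ = 1) ?mulr1; last exact: congr1 (probability_setT P); congr (_ + _).
  rewrite RintegralZl// ?Rintegral_indic//.
  by apply: integrable_indic.
apply: le_Rintegral => //.
  apply: (@integrable_bounded _ _ _ _ _ (M + M)); last by move=> w; rewrite normr_id.
  exact: measurableT_comp.
move=> w _; rewrite indicE; case: (asboolP (w \in S)) => [wS|wS].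
  by rewrite wS mulr1 (le_trans (b12 w))//; lra.
rewrite (negbTE (introN idP wS)) mulr0 addr0 h12// => Sw.
by apply: wS; rewrite inE.
Qed.

(** Convergence in distribution tests only continuous functions, so tail probabilities are trapped
    by integrals of a cutoff, from this side and from that of [Rintegral_le_prob]. *)
Lemma prob_le_Rintegral (R : realType) (d : measure_display)
    (T : measurableType d) (P : probability T R) (h : T -> R) (S : set T) :
  measurable_fun setT h -> (forall w, 0 <= h w <= 1) -> measurable S ->
  (forall w, S w -> h w = 1) -> fine (P S) <= Rintegral P setT h.
Proof.
move=> mh h01 mS hS; rewrite -Rintegral_indic//; apply: le_Rintegral => //.
- exact: integrable_indic.
- by apply: (@integrable_bounded _ _ _ _ _ 1) => // w; have /andP[h0 ?] := h01 w;
    rewrite ger0_norm.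
- move=> w _; have [wS|wS] := boolP (w \in S).
    by rewrite hS//; move: wS; rewrite inE.
  by have /andP[] := h01 w.
Qed.

Lemma Rintegral_le_prob (R : realType) (d : measure_display)
    (T : measurableType d) (P : probability T R) (h : T -> R) (S : set T) :
  measurable_fun setT h -> (forall w, 0 <= h w <= 1) -> measurable S ->
  (forall w, ~ S w -> h w = 0) -> Rintegral P setT h <= fine (P S).
Proof.
move=> mh h01 mS hS; rewrite -Rintegral_indic//; apply: le_Rintegral => //.
- by apply: (@integrable_bounded _ _ _ _ _ 1) => // w; have /andP[h0 ?] := h01 w;
    rewrite ger0_norm.
- exact: integrable_indic.
- move=> w _; have [wS|wS] := boolP (w \in S).
    by have /andP[] := h01 w.
  by rewrite hS// => Sw; move: wS; rewrite notin_setE.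
Qed.

Lemma measurable_gt (R : realType) (d : measure_display)
    (T : measurableType d) (h : T -> R) (a : R) :
  measurable_fun setT h -> measurable [set w | a < h w].
Proof.
move=> mh; have -> : [set w | a < h w] = h @^-1` `]a, +oo[.
  by apply/seteqP; split => w /=; rewrite in_itv/= andbT.
by rewrite -[X in measurable X]setTI; exact: mh.
Qed.

Lemma fine_prob_le (R : realType) (d : measure_display)
    (T : measurableType d) (P : probability T R) (S S' : set T) :
  measurable S -> measurable S' -> S `<=` S' -> fine (P S) <= fine (P S').
Proof.
by move=> mS mS' SS'; rewrite fine_le ?fin_num_measure// le_measure// inE.
Qed.

(** The tails decrease to the empty set because [h] is real-valued; continuity of [P] from above
    concludes. *)
Lemma prob_tail_small (R : realType) (d : measure_display)
    (T : measurableType d) (P : probability T R) (h : T -> R) (e : R) :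
  measurable_fun setT h -> 0 < e ->
  exists n : nat, fine (P [set w | n%:R < h w]) < e.
Proof.
move=> mh e0; pose F n := [set w | n%:R < h w].
have F0 : \bigcap_n F n = set0.
  apply/seteqP; split => // w Fw.
  have := Fw (Num.truncn `|h w|).+1 I; rewrite /F/= ltNge => /negP; apply.
  by rewrite (le_trans (ler_norm _))// ltW// truncnS_gt.
have mF n : measurable (F n) by exact: measurable_gt.
have : (P \o F) x @[x --> \oo] --> P (\bigcap_n F n).
  apply: nonincreasing_cvg_mu => //.
  - by rewrite (le_lt_trans (probability_le1 _ _))// ltry.
  - by rewrite F0.
  - move=> n m nm; apply/subsetPset => w; rewrite /F/=; apply: le_lt_trans.
    by rewrite ler_nat.
rewrite F0 measure0 => /fine_cvgP[_] /cvgrPdist_lt/(_ e e0)[N _ /(_ N (leqnn N))].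
rewrite /= sub0r normrN ger0_norm ?fine_ge0// => ?; by exists N.
Qed.

(** The filter is a parameter because what is known along [\oo] passes to every finer filter, in
    particular to the ultrafilters on which the matrices converge. *)
Definition cvg_dist_along (F : set_system nat) (R : realType) (s : nat)
  (d : measure_display) (T : measurableType d) (P : probability T R)
  (X : nat -> T -> 'cV[R]_s)
  (d' : measure_display) (T' : measurableType d') (P' : probability T' R)
  (Y : T' -> 'cV[R]_s) : Prop :=
  forall f : 'cV[R]_s -> R, continuous f -> Defs.bounded_fun f ->
    (fun n => Rintegral P setT (fun w => f (X n w))) @ F -->
      Rintegral P' setT (fun w => f (Y w)).

Definition cvg_prob0_along (F : set_system nat) (R : realType) (s : nat)
  (d : measure_display) (T : measurableType d) (P : probability T R)
  (Y : nat -> T -> 'cV[R]_s) : Prop :=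
  forall e : R, 0 < e ->
    (fun n => fine (P [set w | e < enorm (Y n w)])) @ F --> (0 : R).

(** Only eventual tails are claimed, so a single radius can be read off the one law of [Y]. *)
Lemma cvg_dist_tight (R : realType) (s : nat) (F : set_system nat)
    (FF : Filter F) (d : measure_display) (T : measurableType d)
    (P : probability T R) (d' : measure_display) (T' : measurableType d')
    (P' : probability T' R) (X : nat -> T -> 'cV[R]_s) (Y : T' -> 'cV[R]_s)
    (e : R) :
  (forall n i, measurable_fun setT (fun w => X n w i 0)) ->
  (forall i, measurable_fun setT (fun w => Y w i 0)) ->
  cvg_dist_along F P X P' Y -> 0 < e ->
  exists2 r, 0 <= r & \forall n \near F, fine (P [set w | r < enorm (X n w)]) < e.
Proof.
move=> mX mY XY e0.
have mYn : measurable_fun setT (fun w => enorm (Y w)).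
  exact: measurable_fun_continuous_comp mY (@continuous_enorm R s).
have [n Pn] := prob_tail_small P' mYn e0.
(* [chi] is the distance of [enorm z] past [n], clamped to [0, 1]. *)
pose chi (z : 'cV[R]_s) :=
  (`|enorm z - n%:R| - `|enorm z - n%:R - 1| + 1) / 2.
have chi01 z : 0 <= chi z <= 1.
  by rewrite /chi; have [] := ger0P (enorm z - n%:R - 1); have [] := ger0P (enorm z - n%:R); lra.
have chic : continuous chi.
  have phic : continuous (fun x : R => (`|x - n%:R| - `|x - n%:R - 1| + 1) / 2).
    move=> x; apply: cvgM; last exact: cvg_cst.
    apply: cvgD; last exact: cvg_cst.
    by apply: cvgB; apply: cvg_norm; repeat (apply: cvgB; last exact: cvg_cst).
  move=> z; exact: continuous_comp (@continuous_enorm R s z) (phic _).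
have chib : Defs.bounded_fun chi.
  by exists 1 => z; have /andP[c0 c1] := chi01 z; rewrite ger0_norm.
have E' : Rintegral P' setT (fun w => chi (Y w)) < e.
  apply: le_lt_trans Pn; apply: Rintegral_le_prob => //.
  - exact: measurable_fun_continuous_comp.
  - exact: measurable_gt.
  - move=> w /= /negP; rewrite -leNgt => h; rewrite /chi !ler0_norm; lra.
(* The cutoff vanishes up to [n] and is 1 from [n + 1] on, hence a radius one larger than that of
   [Y]. *)
exists (n%:R + 1); first by rewrite addr_ge0.
have h : F ((fun n => Rintegral P setT (fun w => chi (X n w))) @^-1`
    [set x | x < e]).
  exact: XY chic chib _ (lt_nbhsl E').
apply: filterS h => k /=; apply: le_lt_trans; apply: prob_le_Rintegral => //.
- exact: measurable_fun_continuous_comp.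
- apply: measurable_gt; exact: measurable_fun_continuous_comp (mX k) (@continuous_enorm R s).
- move=> w /= h; rewrite /chi !ger0_norm; lra.
Qed.

(** * Ultrafilter limits *)

(** The pushforward of an ultrafilter is an ultrafilter, here one containing a compact segment. *)
Lemma ultra_bounded_cvg (R : realType) (I : Type) (U : set_system I) (u : I -> R)
    (M : R) :
  UltraFilter U -> (forall k, `|u k| <= M) -> exists l : R, u @ U --> l.
Proof.
move=> UU uM.
have uU : UltraFilter (u @ U).
  split; first exact: fmap_proper_filter.
  move=> G GF uG; apply/seteqP; split => // A GA.
  have [//|UnA] := in_ultra_setVsetC (u @^-1` A) UU.
  have /filterI/(_ GA) : G (~` A) by apply: uG.
  by rewrite setICl => /filter_not_empty.
have := @segment_compact R (- M) M; rewrite compact_ultra => /(_ _ uU)[].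
  by apply: (@filterE _ U _) => k /=; rewrite in_itv/= -ler_norml.
by move=> l [_ ul]; exists l.
Qed.

(** If the preimage of a neighbourhood were missing from [F], then [F] restricted to its complement
    would be proper, and an ultrafilter extending it would contain both the preimage and the
    complement. *)
Lemma cvg_ultra (V : topologicalType) (I : Type) (F : set_system I) (u : I -> V)
    (l : V) : Filter F ->
  (forall U, UltraFilter U -> F `<=` U -> u @ U --> l) -> u @ F --> l.
Proof.
move=> FF H A lA; apply: contrapT => nFA.
have wF : ProperFilter (within (~` (u @^-1` A)) F).
  split; last exact: within_filter.
  move=> /= wF0; apply: nFA; move: wF0; rewrite /within/=.
  by apply: filterS => k h; apply: contrapT.
have [U [UU wU]] := ultraFilterLemma wF.
have UA : U (u @^-1` A).
  by apply: H lA => // B FB; apply: wU; move: FB; apply: filterS.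
have UnA : U (~` (u @^-1` A)).
  by apply: wU; apply: (@filterE _ F).
have : U set0 by rewrite -(setICr (u @^-1` A)); exact: filterI.
exact: filter_not_empty.
Qed.

(** Compactness of the ball: counterexamples at scale [k.+1%:R^-1] would have both components
    converging, along an ultrafilter, to one point where [g] is continuous. *)
Lemma uniform_continuity_ball (R : realType) (s : nat) (g : 'cV[R]_s -> R)
    (r e : R) :
  continuous g -> 0 < e ->
  exists2 dlt, 0 < dlt & forall x y : 'cV[R]_s, enorm y <= r ->
    enorm (x - y) <= dlt -> `|g x - g y| < e.
Proof.
move=> gc e0; apply: contrapT => nex.
have /choice[xy Hxy] (k : nat) : exists xy : 'cV[R]_s * 'cV[R]_s,
    [/\ enorm xy.2 <= r, enorm (xy.1 - xy.2) <= k.+1%:R^-1 &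
        e <= `|g xy.1 - g xy.2|].
  apply: contrapT => nxy; apply: nex; exists k.+1%:R^-1 => // x y yr xyk.
  by rewrite ltNge; apply/negP => ge; apply: nxy; exists (x, y).
have [U [UU oU]] := ultraFilterLemma (eventually_filter : ProperFilter \oo).
have /choice[l hl] (i : 'I_s) : exists l : R, (fun k => (xy k).2 i 0) @ U --> l.
  apply: (@ultra_bounded_cvg _ _ _ _ r) => k.
  by have [h _ _] := Hxy k; exact: le_trans (coord_le_enorm _ _) h.
pose y : 'cV[R]_s := \col_i l i.
have c2 : (fun k => (xy k).2) @ U --> y.
  by apply/cvg_mxP => i j; rewrite ord1 mxE; exact: hl.
have c1 : (fun k => (xy k).1) @ U --> y.
  apply/cvg_mxP => i j; rewrite ord1.
  have -> : (fun k => (xy k).1 i 0) =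
     (fun k => ((xy k).1 - (xy k).2) i 0 + (xy k).2 i 0).
    by apply/funext => k; rewrite !mxE subrK.
  rewrite -[y i 0]add0r; apply: cvgD; last by rewrite mxE; exact: hl.
  apply: (@cvg_trans _ (((fun k => ((xy k).1 - (xy k).2) i 0) @ \oo))).
    by move=> A /oU.
  apply/cvgrPdist_lt => _/posnumP[q]; near=> k; rewrite sub0r normrN.
  have [_ h _] := Hxy k; apply: (le_lt_trans (coord_le_enorm _ _)).
  by apply: (le_lt_trans h); near: k; exact: near_infty_natSinv_lt.
have : (fun k => g (xy k).1 - g (xy k).2) @ U --> g y - g y.
  by apply: cvgB; [exact: cvg_comp c1 (gc y)|exact: cvg_comp c2 (gc y)].
rewrite subrr => /cvgrPdist_lt/(_ e e0) /filter_ex[k].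
have [_ _ h] := Hxy k; by rewrite sub0r normrN ltNge h.
Unshelve. all: end_near. Qed.

(** * Convergence in distribution along a filter *)

Lemma measurable_mulmx_coord (R : realType) (m n : nat) (d : measure_display)
    (T : measurableType d) (A : 'M[R]_(m, n)) (X : T -> 'cV[R]_n) :
  (forall i, measurable_fun setT (fun w => X w i 0)) ->
  forall i, measurable_fun setT (fun w => (A *m X w) i 0).
Proof.
move=> mX i; have -> : (fun w => (A *m X w) i 0) =
    (fun w => \sum_k A i k * X w k 0) by apply/funext => w; rewrite mxE.
by apply: measurable_sum => k; apply: measurable_funM.
Qed.

Lemma measurable_subr_coord (R : realType) (n : nat) (d : measure_display)
    (T : measurableType d) (X Y : T -> 'cV[R]_n) :
  (forall i, measurable_fun setT (fun w => X w i 0)) ->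
  (forall i, measurable_fun setT (fun w => Y w i 0)) ->
  forall i, measurable_fun setT (fun w => (X w - Y w) i 0).
Proof.
move=> mX mY i; have -> : (fun w => (X w - Y w) i 0) =
    (fun w => X w i 0 - Y w i 0) by apply/funext => w; rewrite !mxE.
exact: measurable_funB.
Qed.

Lemma measurable_enorm (R : realType) (n : nat) (d : measure_display)
    (T : measurableType d) (X : T -> 'cV[R]_n) :
  (forall i, measurable_fun setT (fun w => X w i 0)) ->
  measurable_fun setT (fun w => enorm (X w)).
Proof.
by move=> mX; exact: measurable_fun_continuous_comp mX (@continuous_enorm R n).
Qed.

(** Tightness of [Y] confines the comparison to a ball, where [f] is uniformly continuous; the bad
    event is that [Y n] leaves the ball or [X n] is far from [Y n]. *)
Lemma slutsky (R : realType) (s : nat) (F : set_system nat)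
    (FF : Filter F) (d : measure_display) (T : measurableType d)
    (P : probability T R) (d' : measure_display) (T' : measurableType d')
    (P' : probability T' R) (X Y : nat -> T -> 'cV[R]_s) (Y' : T' -> 'cV[R]_s) :
  (forall n i, measurable_fun setT (fun w => X n w i 0)) ->
  (forall n i, measurable_fun setT (fun w => Y n w i 0)) ->
  (forall i, measurable_fun setT (fun w => Y' w i 0)) ->
  cvg_dist_along F P Y P' Y' ->
  cvg_prob0_along F P (fun n w => X n w - Y n w) ->
  cvg_dist_along F P X P' Y'.
Proof.
move=> mX mY mY' YY' XY f fc [M fM].
apply/cvgrPdist_lt => e e0.
have M0 : 0 <= M by rewrite (le_trans _ (fM 0)).
(* Two bad events of probability below [q] cost at most [2 * M * (q + q) < e / 2]; the other two
   errors take [e / 4] each. Using [M + 1] covers [M = 0]. *)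
pose q := e / (8 * (M + 1)).
have M1 : 0 < 8 * (M + 1) by lra.
have q0 : 0 < q by rewrite divr_gt0.
have qM : 4 * M * q < e / 2.
  have : q * (8 * (M + 1)) = e by rewrite /q divfK// gt_eqF.
  lra.
have [r r0 Pr] := cvg_dist_tight FF mY mY' YY' q0.
have e4 : 0 < e / 4 by lra.
have [dl dl0 Hdl] := uniform_continuity_ball r fc e4.
have h1 : \forall n \near F, fine (P [set w | dl < enorm (X n w - Y n w)]) < q.
  have := XY dl dl0 => /cvgrPdist_lt/(_ q q0); apply: filterS => n.
  by rewrite sub0r normrN; apply: le_lt_trans; exact: ler_norm.
have h2 : \forall n \near F, `|Rintegral P' setT (fun w => f (Y' w)) -
    Rintegral P setT (fun w => f (Y n w))| < e / 4.
  have := YY' f fc (ex_intro _ M fM) => /cvgrPdist_lt; exact.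
near=> n.
have p1 : fine (P [set w | r < enorm (Y n w)]) < q by near: n; exact: Pr.
have p2 : fine (P [set w | dl < enorm (X n w - Y n w)]) < q by near: n; exact: h1.
have p3 : `|Rintegral P' setT (fun w => f (Y' w)) -
    Rintegral P setT (fun w => f (Y n w))| < e / 4 by near: n; exact: h2.
set S1 := [set w | r < _] in p1; set S2 := [set w | dl < _] in p2.
have mS1 : measurable S1 by apply: measurable_gt; exact: measurable_enorm.
have mS2 : measurable S2.
  by apply: measurable_gt; apply: measurable_enorm; exact: measurable_subr_coord.
have pU : fine (P (S1 `|` S2)) <= fine (P S1) + fine (P S2).
  rewrite -fineD ?fin_num_measure// fine_le ?fin_numD ?fin_num_measure//.
    exact: measurableU.
  exact: measureU2.
have hc := @Rintegral_close R d T P (fun w => f (X n w)) (fun w => f (Y n w))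
  M (e / 4) (S1 `|` S2).
have {}hc : `|Rintegral P setT (fun w => f (X n w)) -
    Rintegral P setT (fun w => f (Y n w))| <= e / 4 + 2 * M * fine (P (S1 `|` S2)).
  apply: hc => //.
  - exact: measurable_fun_continuous_comp.
  - exact: measurable_fun_continuous_comp.
  - exact: ltW.
  - exact: measurableU.
  - move=> w /not_orP[/negP + /negP]; rewrite -!leNgt => ? ?.
    exact/ltW/Hdl.
rewrite distrC in p3.
rewrite distrC (le_lt_trans (ler_distD (Rintegral P setT (fun w => f (Y n w))) _ _))//.
have : 2 * M * fine (P (S1 `|` S2)) <= 2 * M * (q + q).
  apply: ler_wpM2l; first by rewrite mulr_ge0.
  by rewrite (le_trans pU)// lerD// ltW.
lra.
Unshelve. all: by end_near. Qed.

(** Once [b n * r ^+ k < e], a value of [W n] beyond [e] forces [Z n] beyond [r]. The exponent is 2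
    for the linearization remainder and 1 for replacing [A n] by its limit. *)
Lemma cvg_prob0_dominated (R : realType) (s : nat) (F : set_system nat)
    (FF : Filter F) (d : measure_display) (T : measurableType d)
    (P : probability T R) (d' : measure_display) (T' : measurableType d')
    (P' : probability T' R) (Z W : nat -> T -> 'cV[R]_s) (Z' : T' -> 'cV[R]_s)
    (b : nat -> R) (k : nat) :
  (forall n i, measurable_fun setT (fun w => Z n w i 0)) ->
  (forall n i, measurable_fun setT (fun w => W n w i 0)) ->
  (forall i, measurable_fun setT (fun w => Z' w i 0)) ->
  cvg_dist_along F P Z P' Z' ->
  (forall n, 0 <= b n) -> b @ F --> (0 : R) ->
  (forall n w, enorm (W n w) <= b n * enorm (Z n w) ^+ k) ->
  cvg_prob0_along F P W.
Proof.
move=> mZ mW mZ' ZZ' b0 bF WZ e e0.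
apply/cvgrPdist_lt => q q0.
have [r r0 Pr] := cvg_dist_tight FF mZ mZ' ZZ' q0.
have h1 : \forall n \near F, b n * r ^+ k < e.
  have : (fun n => b n * r ^+ k) @ F --> 0 * r ^+ k by apply: cvgM => //; exact: cvg_cst.
  rewrite mul0r => /cvgrPdist_lt/(_ e e0); apply: filterS => n.
  by rewrite sub0r normrN; apply: le_lt_trans; exact: ler_norm.
near=> n; rewrite sub0r normrN ger0_norm ?fine_ge0//.
have p1 : fine (P [set w | r < enorm (Z n w)]) < q by near: n; exact: Pr.
have p2 : b n * r ^+ k < e by near: n; exact: h1.
apply: le_lt_trans p1; apply: fine_prob_le.
- by apply: measurable_gt; exact: measurable_enorm.
- by apply: measurable_gt; exact: measurable_enorm.
move=> w /= eW; rewrite ltNge; apply/negP => Zr.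
have : e < e; last by rewrite ltxx.
apply: (lt_trans eW); apply: le_lt_trans p2; apply: (le_trans (WZ n w)).
by rewrite ler_wpM2l// lerXn2r// ?nnegrE ?enorm_ge0.
Unshelve. all: by end_near. Qed.

Lemma cvg_dist_mulmx (R : realType) (s : nat) (F : set_system nat)
    (FF : Filter F) (d : measure_display) (T : measurableType d)
    (P : probability T R) (d' : measure_display) (T' : measurableType d')
    (P' : probability T' R) (Z : nat -> T -> 'cV[R]_s) (Z' : T' -> 'cV[R]_s)
    (A : nat -> 'M[R]_s) (A0 : 'M[R]_s) :
  (forall n i, measurable_fun setT (fun w => Z n w i 0)) ->
  (forall i, measurable_fun setT (fun w => Z' w i 0)) ->
  cvg_dist_along F P Z P' Z' -> A @ F --> A0 ->
  cvg_dist_along F P (fun n w => A n *m Z n w) P' (fun w => A0 *m Z' w).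
Proof.
move=> mZ mZ' ZZ' AA0.
apply: (@slutsky _ _ _ _ _ _ _ _ _ _ _ (fun n w => A0 *m Z n w)).
- by move=> n; exact: measurable_mulmx_coord.
- by move=> n; exact: measurable_mulmx_coord.
- exact: measurable_mulmx_coord.
- move=> f fc [M fM]; apply: (ZZ' (fun z => f (A0 *m z))); last by exists M.
  by move=> z; exact: continuous_comp (@continuous_mulmx R s s 1 A0 z) (fc _).
apply: (@cvg_prob0_dominated _ _ _ _ _ _ _ _ _ P' Z _ Z' (fun n => fnorm (A n - A0)) 1) => //.
- move=> n; apply: measurable_subr_coord; exact: measurable_mulmx_coord.
- by move=> n; apply: sumr_ge0 => i _; apply: sumr_ge0.
- have -> : 0 = \sum_(i < s) \sum_(j < s) `|A0 i j - A0 i j| :> R.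
    by rewrite big1// => i _; rewrite big1// => j _; rewrite subrr normr0.
  apply: (cvg_big add_continuous) => i _; apply: (cvg_big add_continuous) => j _.
  have -> : (fun n => `|(A n - A0) i j|) = (fun n => `|A n i j - A0 i j|).
    by apply/funext => n; rewrite !mxE.
  apply: cvg_norm; apply: cvgB; last exact: cvg_cst.
  by move: i j; apply/cvg_mxP.
- by move=> n w; rewrite -mulmxBl expr1 enorm_mulmx_fnorm.
Qed.

(** * Square roots of tangent projections *)

(* [A] is singular since [A^T mu = 0]; take [H = A + mu nu^T] for a unit vector
   [nu] in its kernel. *)
Lemma tanp_factor (R : realType) (s : nat) (A : 'M[R]_s) (mu : 'cV[R]_s) :
  enorm mu = 1 -> A *m A^T = tanp mu ->
  exists2 H : 'M[R]_s, H^T *m H = 1%:M & A = tanp mu *m H.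
Proof.
move=> mu1 AA.
(* The squared norm of [A^T *m mu] is [dotc mu (A *m A^T *m mu)], and [tanp mu] kills [mu]. *)
have ATmu : A^T *m mu = 0.
  apply/eqP; rewrite -enorm_eq0 -sqrf_eq0 sqr_enorm dotc_mulmxl trmxK mulmxA AA.
  by rewrite tanp_self// -(scale0r 0) dotcZr mul0r.
have mu0 : mu != 0 by rewrite -enorm_gt0 mu1.
have muA : mu^T *m A = 0 by apply: trmx_inj; rewrite trmx_mul trmxK linear0.
have detA : \det A^T = 0.
  rewrite det_tr; apply/eqP/det0P; exists mu^T => //.
  by apply: contra_neq mu0 => /(congr1 trmx); rewrite trmxK linear0.
have /eqP/det0P[v v0 vA] := detA.
pose nu : 'cV[R]_s := (enorm v^T)^-1 *: v^T.
have Anu : A *m nu = 0.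
  rewrite -scalemxAr; apply: trmx_inj.
  by rewrite linearZ/= trmx_mul trmxK vA scaler0 linear0.
have nu1 : enorm nu = 1.
  apply: enorm_proj_sph; apply: contra_neq v0 => /(congr1 trmx).
  by rewrite trmxK linear0.
(* Since [A *m nu = 0], the cross terms vanish and [tanp mu + mu *m mu^T] is left. *)
have HHT : (A + mu *m nu^T) *m (A + mu *m nu^T)^T = 1%:M.
  rewrite linearD/= trmx_mul trmxK mulmxDl !mulmxDr AA mulmxA Anu mul0mx addr0.
  have -> : mu *m nu^T *m A^T = 0.
    by rewrite -mulmxA -trmx_mul Anu linear0 mulmx0.
  rewrite add0r mulmxA -(mulmxA mu) mulmx_trl -sqr_enorm nu1 expr1n mulmx1.
  by rewrite /tanp subrK.
exists (A + mu *m nu^T); first exact: mulmx1C.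
by rewrite mulmxDr mulmxA tanp_self// mul0mx addr0 mulmxBl mul1mx -mulmxA muA
  mulmx0 subr0.
Qed.

Lemma householder (R : realType) (s : nat) (mu nu : 'cV[R]_s) :
  enorm mu = 1 -> enorm nu = 1 ->
  exists2 O : 'M[R]_s, O^T *m O = 1%:M & O *m nu = mu.
Proof.
move=> mu1 nu1; have [->|munu] := eqVneq mu nu.
  by exists 1%:M; rewrite ?trmx1 ?mul1mx.
set v := mu - nu; set c := 2 / dotc v v.
have v0 : dotc v v != 0.
  by rewrite -sqr_enorm sqrf_eq0 enorm_eq0 subr_eq0.
have cv : c * dotc v v = 2 by rewrite divfK.
(* Equal lengths of [mu] and [nu] give this identity, so the reflection along [v] sends [nu] to
   [nu + v = mu]. *)
have vv : dotc v v = - 2 * dotc v nu.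
  rewrite {2}/v -scaleN1r dotcDr dotcZr /v -scaleN1r !dotcDl !dotcZl -!sqr_enorm.
  by rewrite mu1 nu1 (dotcC nu mu); ring.
exists (1%:M - c *: (v *m v^T)).
  set K := v *m v^T.
  have KT : K^T = K by rewrite trmx_mul trmxK.
  have KK : K *m K = dotc v v *: K.
    by rewrite mulmxA -(mulmxA v) mulmx_trl mul_mx_scalar -scalemxAl.
  have -> : (1%:M - c *: K)^T = 1%:M - c *: K.
    by rewrite linearB/= linearZ/= trmx1 KT.
  rewrite mulmxBl mul1mx mulmxBr mulmx1 -scalemxAl -scalemxAr KK !scalerA.
  have -> : c * c * dotc v v = 2 * c by rewrite -mulrA cv mulrC.
  move: K {KT KK} => K.
  by apply/matrixP => i j; rewrite !mxE; ring.
rewrite mulmxBl mul1mx -scalemxAl -mulmxA mulmx_trl mul_mx_scalar scalerA.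
have -> : c * dotc v nu = - 1 by move: cv; rewrite vv; lra.
by rewrite scaleN1r opprK /v addrC subrK.
Qed.

Lemma tanp_conj (R : realType) (s : nat) (mu : 'cV[R]_s) (O : 'M[R]_s) :
  O^T *m O = 1%:M -> tanp (O *m mu) = O *m tanp mu *m O^T.
Proof.
move=> OO; rewrite /tanp mulmxBr mulmx1 mulmxBl (mulmx1C OO) trmx_mul.
by rewrite !mulmxA.
Qed.

Lemma enorm_orthogonal (R : realType) (s : nat) (v : 'cV[R]_s) (O : 'M[R]_s) :
  O^T *m O = 1%:M -> enorm (O *m v) = enorm v.
Proof. by move=> OO; rewrite !enormE dotc_mulmxl mulmxA OO mul1mx. Qed.

(** * Linearization and spherical laws *)

Lemma linearization_error (R : realType) (s : nat) (t tt : 'cV[R]_s)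
    (B Gam : 'M[R]_s) (eps C : R) :
  t != 0 -> B \in unitmx -> `|eps| <= C * enorm t ->
  let mu := proj_sph t in
  let G := enorm t *: tanp mu + eps *: (1%:M - tanp mu) in
  let z := invmx B *m (tt - t) in
  is_true (enorm (Gam *m G *m (proj_sph tt - mu) - (Gam *m tanp mu *m B) *m z)
    <= 12 * (2 + C) * (opnorm Gam * opnorm B ^+ 2 / enorm t) * enorm z ^+ 2).
Proof.
move=> t0 uB epsC mu G z.
have tp : 0 < enorm t by rewrite enorm_gt0.
have mu1 : enorm mu = 1 by exact: enorm_proj_sph.
pose v := (enorm t)^-1 *: (B *m z).
have ttE : proj_sph tt = proj_sph (mu + v).
  rewrite /mu /v /proj_sph -scalerDr /z mulKVmx// addrC subrK.
  by rewrite -!/(proj_sph _) proj_sphZ// invr_gt0.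
pose rho := proj_sph (mu + v) - mu - tanp mu *m v.
have rho_le : enorm rho <= 12 * enorm v ^+ 2 by exact: proj_sph_expansion.
(* On tangent vectors [G] acts as the scalar [enorm t], whatever [eps] is, which undoes the division
   in [v]. *)
have Gtan : G *m (tanp mu *m v) = tanp mu *m (B *m z).
  have -> : G *m (tanp mu *m v) = enorm t *: (tanp mu *m v).
    rewrite mulmxA mulmxDl -!scalemxAl tanp_idem// (mulmxBl 1%:M (tanp mu)).
    by rewrite mul1mx tanp_idem// subrr scaler0 addr0 -scalemxAl.
  by rewrite /v -scalemxAr scalerA divff ?gt_eqF// scale1r.
have -> : Gam *m G *m (proj_sph tt - mu) - (Gam *m tanp mu *m B) *m z =
    Gam *m (G *m rho).
  rewrite ttE -(mulmxA Gam G) -(mulmxA Gam (tanp mu)) -(mulmxA Gam) -mulmxBr.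
  by rewrite -(mulmxA (tanp mu)) -Gtan -mulmxBr.
(* The 2 bounds the tangential part of [rho] by the triangle inequality; the [C] comes from [eps]
   acting on its normal part. *)
have Grho : enorm (G *m rho) <= (2 + C) * enorm t * enorm rho.
  have -> : G *m rho = enorm t *: (rho - dotc mu rho *: mu) + eps *: (dotc mu rho *: mu).
    rewrite mulmxDl -!scalemxAl (mulmxBl 1%:M (tanp mu)) mul1mx tanp_mulmx.
    congr (_ + _ *: _).
    by rewrite opprB addrC subrK.
  have a1 : `|dotc mu rho| <= enorm rho.
    by rewrite (le_trans (cauchy_schwarz _ _))// mu1 mul1r.
  apply: (le_trans (enormD _ _)).
  rewrite (enormZ (enorm t)) (enormZ eps) (enormZ (dotc _ _)) mu1 mulr1 ger0_norm ?enorm_ge0//.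
  rewrite -mulrA mulrDl; apply: lerD.
    rewrite mulrCA ler_wpM2l ?enorm_ge0//. rewrite  (le_trans (enormB _ _))// enormZ mu1.
    by rewrite mulr1 mulr_natl mulr2n lerD.
  by rewrite mulrA ler_pM.
have C0 : 0 <= C by rewrite -(pmulr_lge0 _ tp) (le_trans _ epsC).
have Gam0 := opnorm_ge0 Gam t0.
have vle : enorm v <= (enorm t)^-1 * (opnorm B * enorm z).
  by rewrite enormZ ger0_norm ?invr_ge0 ?enorm_ge0// ler_wpM2l ?invr_ge0
    ?enorm_ge0// enorm_mulmx.
apply: (le_trans (enorm_mulmx _ _)).
apply: (@le_trans _ _ (opnorm Gam * ((2 + C) * enorm t *
    (12 * ((enorm t)^-1 * (opnorm B * enorm z)) ^+ 2)))).
  apply: ler_wpM2l => //; apply: (le_trans Grho); apply: ler_wpM2l.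
    by rewrite mulr_ge0 ?addr_ge0 ?enorm_ge0.
  apply: (le_trans rho_le); apply: ler_wpM2l => //.
  by rewrite ler_sqr ?nnegrE ?enorm_ge0// (le_trans _ vle)// enorm_ge0.
rewrite le_eqVlt; apply/orP; left; apply/eqP.
by field; rewrite gt_eqF.
Qed.

(** The Gram identity itself bounds [A n]: the squared norm of its row [i] is the diagonal entry
    [1 - mu_i ^+ 2] of the projection. The identity is polynomial in the entries, so it survives the
    limit. *)
Lemma tangent_gram_ultralimit (R : realType) (s : nat) (U : set_system nat)
    (A : nat -> 'M[R]_s) (mu : nat -> 'cV[R]_s) :
  UltraFilter U -> (forall n, enorm (mu n) = 1) ->
  (forall n, A n *m (A n)^T = tanp (mu n)) ->
  exists (A0 : 'M[R]_s) (mu0 : 'cV[R]_s), [/\ A @ U --> A0, mu @ U --> mu0, enorm mu0 = 1 &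
                     A0 *m A0^T = tanp mu0].
Proof.
move=> UU mu1 AA.
have A1 i j n : `|A n i j| <= 1.
  have := congr1 (fun M : 'M[R]_s => M i i) (AA n); rewrite !mxE eqxx big_ord1 !mxE => Aii.
  rewrite -(@ler_sqr _ `|_| 1) ?nnegrE// real_normK ?num_real// expr1n.
  apply: (@le_trans _ _ (\sum_k A n i k * (A n)^T k i)).
    rewrite (bigD1 j)//= mxE -expr2 lerDl; apply: sumr_ge0 => k _.
    by rewrite mxE -expr2 sqr_ge0.
  by rewrite Aii -expr2 lerBlDr lerDl sqr_ge0.
have /choice[a0 ha] : forall p : 'I_s * 'I_s, exists l : R, (fun n => A n p.1 p.2) @ U --> l.
  by move=> p; apply: ultra_bounded_cvg; exact: A1.
have /choice[m0 hm] : forall i : 'I_s, exists l : R, (fun n => mu n i 0) @ U --> l.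
  move=> i; apply: (@ultra_bounded_cvg _ _ _ _ 1) => n.
  by rewrite -(mu1 n) coord_le_enorm.
pose A0 : 'M[R]_s := \matrix_(i, j) a0 (i, j).
pose mu0 : 'cV[R]_s := \col_i m0 i.
have AU : A @ U --> A0 by apply/cvg_mxP => i j; rewrite mxE; exact: (ha (i, j)).
have mU : mu @ U --> mu0 by apply/cvg_mxP => i j; rewrite ord1 mxE; exact: hm.
exists A0, mu0; split => //.
  have : (fun n => enorm (mu n)) @ U --> enorm mu0.
    exact: cvg_comp mU (@continuous_enorm R s mu0).
  rewrite (funext mu1) => h; apply: (@cvg_unique _ (@Rhausdorff R) _ _ _ _ h).
  exact: cvg_cst.
apply/matrixP => i j.
have h1 : (fun n => (A n *m (A n)^T) i j) @ U --> (A0 *m A0^T) i j.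
  have -> : (fun n => (A n *m (A n)^T) i j) = (fun n => \sum_k A n i k * A n j k).
    by apply/funext => n; rewrite mxE; apply: eq_bigr => k _; rewrite mxE.
  rewrite mxE; apply: (cvg_big add_continuous) => k _; apply: cvgM.
    by move: i k; apply/cvg_mxP.
  by rewrite mxE; move: j k; apply/cvg_mxP.
have h2 : (fun n => (A n *m (A n)^T) i j) @ U --> (tanp mu0) i j.
  have -> : (fun n => (A n *m (A n)^T) i j) =
      (fun n => (i == j)%:R - mu n i 0 * mu n j 0).
    by apply/funext => n; rewrite AA !mxE big_ord1 mxE.
  rewrite !mxE big_ord1 !mxE; apply: cvgB; first exact: cvg_cst.
  by apply: cvgM; exact: hm.
exact: (@cvg_unique _ (@Rhausdorff R) _ _ _ _ h1 h2).
Qed.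

Lemma continuous_sqr_enorm (R : realType) (s : nat) :
  continuous (fun z : 'cV[R]_s => enorm z ^+ 2).
Proof.
move=> z; exact: continuous_comp (@continuous_enorm R s z)
  (@exprn_continuous R 2 _).
Qed.

Lemma spherical_gram (R : realType) (s : nat) (d' : measure_display)
    (T' : measurableType d') (P' : probability T' R) (Z : T' -> 'cV[R]_s)
    (A : 'M[R]_s) (mu : 'cV[R]_s) :
  spherical P' Z -> enorm mu = 1 -> A *m A^T = tanp mu ->
  eq_dist P' (fun w => A *m Z w) (fun w => tanp mu *m Z w).
Proof.
move=> sZ mu1 AA f fc [M fM]; have [H HH ->] := tanp_factor mu1 AA.
under eq_Rintegral do rewrite -mulmxA.
apply: (sZ H HH (fun z => f (tanp mu *m z))); last by exists M.
by move=> z; exact: continuous_comp (@continuous_mulmx R s s 1 (tanp mu) z) (fc _).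
Qed.

(** If [mu = O *m nu], then [tanp mu = O *m tanp nu *m O^T]: the norm ignores the outer [O], and
    sphericity absorbs the inner [O^T]. *)
Lemma spherical_sqr_tanp (R : realType) (s : nat) (d' : measure_display)
    (T' : measurableType d') (P' : probability T' R) (Z : T' -> 'cV[R]_s)
    (mu nu : 'cV[R]_s) :
  spherical P' Z -> enorm mu = 1 -> enorm nu = 1 ->
  eq_dist P' (fun w => enorm (tanp mu *m Z w) ^+ 2)
             (fun w => enorm (tanp nu *m Z w) ^+ 2).
Proof.
move=> sZ mu1 nu1 f fc [M fM]; case: (householder mu1 nu1) => O OO <-.
rewrite tanp_conj//.
under eq_Rintegral do rewrite -2!mulmxA enorm_orthogonal//.
have OTOT : O^T^T *m O^T = 1%:M by rewrite trmxK mulmx1C.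
apply: (sZ _ OTOT (fun z => f (enorm (tanp nu *m z) ^+ 2))); last by exists M.
move=> z; have gc := continuous_comp (@continuous_mulmx R s s 1 (tanp nu) z)
  (@continuous_sqr_enorm R s _).
exact: continuous_comp gc (fc _).
Qed.

(** Projecting orthogonally to the last basis vector deletes the last coordinate, which produces the
    sum of [s.-1] squares defining the limit law in (3). *)
Lemma sqr_enorm_tanp_last (R : realType) (s : nat) : (0 < s)%N ->
  exists2 nu : 'cV[R]_s, enorm nu = 1 & forall z : 'cV[R]_s,
    enorm (tanp nu *m z) ^+ 2 = \sum_(i < s | (i < s.-1)%N) (z i 0) ^+ 2.
Proof.
case: s => // s _; pose e : 'cV[R]_s.+1 := delta_mx ord_max 0.
have ez z : dotc e z = z ord_max 0.
  rewrite /dotc (bigD1 ord_max)//= mxE !eqxx mul1r big1 ?addr0// => i /negbTE ii.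
  by rewrite mxE ii mul0r.
have ee : dotc e e = 1 by rewrite ez mxE !eqxx.
exists e => [|z]; first by rewrite enormE ee sqrtr1.
rewrite tanp_mulmx ez sqr_enorm /dotc [RHS]big_mkcond/=; apply: eq_bigr => i _.
rewrite !mxE eqxx andbT; have [->|iM] := eqVneq i ord_max.
  by rewrite ltnn mulr1 subrr mulr0.
have -> : (i < s)%N by rewrite ltn_neqAle -ltnS ltn_ord andbT.
by rewrite mulr0 subr0 expr2.
Qed.

Unset Implicit Arguments. Set Strict Implicit. Set Printing Implicit Defensive.

Theorem theorem6p1 (R : realType) (s : nat)
  (d : measure_display) (T : measurableType d) (P : probability T R)
  (d' : measure_display) (T' : measurableType d') (P' : probability T' R)
  (t : nat -> 'cV[R]_s) (tt : nat -> T -> 'cV[R]_s) (B : nat -> 'M[R]_s)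
  (Z : T' -> 'cV[R]_s) (D : R) (eps : nat -> R) (Gam : nat -> 'M[R]_s) :
  (forall n i, measurable_fun setT (fun w => tt n w i 0)) ->
  (forall i, measurable_fun setT (fun w => Z w i 0)) ->
  (forall n, B n \in unitmx) ->
  (fun n => opnorm (B n)) @ \oo --> (0 : R) ->
  cvg_dist P (fun n w => invmx (B n) *m (tt n w - t n)) P' Z ->
  (forall n, t n != 0) ->
  (forall n, dist_set (t n) (@sphere R s) <= D) ->
  (fun n => opnorm (B n) / enorm (t n)) @ \oo --> (0 : R) ->
  (exists C : R, forall n, `|eps n| <= C * enorm (t n)) ->
  (fun n => opnorm (Gam n) * opnorm (B n) ^+ 2 / enorm (t n)) @ \oo --> (0 : R) ->
  let mu n := proj_sph (t n) in
  let mut n w := proj_sph (tt n w) in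
  let G n := enorm (t n) *: tanp (mu n) + eps n *: (1%:M - tanp (mu n)) in
  let Zn n w := invmx (B n) *m (tt n w - t n) in
  let lhs n w := Gam n *m G n *m (mut n w - mu n) in
  let rhs n w := (Gam n *m tanp (mu n) *m B n) *m Zn n w in
  (* (1) *)
  cvg_prob0 P (fun n w => lhs n w - rhs n w) /\
  (spherical P' Z ->
   (forall n, Gam n *m tanp (mu n) *m B n *m (B n)^T *m tanp (mu n) *m (Gam n)^T
              = tanp (mu n)) ->
   (* (2) *)
   (forall mu0 : 'cV[R]_s, sphere mu0 ->
      (fun n => enorm (mu n - mu0)) @ \oo --> (0 : R) ->
      cvg_dist P rhs P' (fun w => tanp mu0 *m Z w) /\
      cvg_dist P lhs P' (fun w => tanp mu0 *m Z w)) /\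
   (* (3) *)
   cvg_dist P
     (fun n w => ((mut n w - mu n)^T *m G n *m (Gam n)^T *m Gam n *m G n
                  *m (mut n w - mu n)) 0 0)
     P' (fun w => \sum_(i < s | (i < s.-1)%N) (Z w i 0) ^+ 2)).
Proof.
move=> mtt mZ uB B0 ZZ' t0 _ BT [C epsC] GB mu mut G Zn lhs rhs.
have tp n : 0 < enorm (t n) by rewrite enorm_gt0.
have mu1 n : enorm (mu n) = 1 by exact: enorm_proj_sph.
have mZn n i : measurable_fun setT (fun w => Zn n w i 0).
  by apply: measurable_mulmx_coord; exact: measurable_subr_coord.
have mrhs n i : measurable_fun setT (fun w => rhs n w i 0).
  exact: measurable_mulmx_coord.
have mlhs n i : measurable_fun setT (fun w => lhs n w i 0).
  apply: measurable_mulmx_coord; apply: measurable_subr_coord => // j.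
  (* [tt n] may vanish, so the inverse of its norm has to be measurable across 0. *)
  have -> : (fun w => mut n w j 0) = (fun w => (enorm (tt n w))^-1 * tt n w j 0).
    by apply/funext => w; rewrite mxE.
  by apply: measurable_funM => //; apply: measurable_funV; exact: measurable_enorm.
have C0 : 0 <= C by rewrite -(pmulr_lge0 _ (tp 0%N)) (le_trans _ (epsC 0%N)).
have lhs_rhs : cvg_prob0 P (fun n w => lhs n w - rhs n w).
  apply: (@cvg_prob0_dominated _ _ \oo _ _ _ _ _ _ P' Zn _ Z (fun n =>
    12 * (2 + C) * (opnorm (Gam n) * opnorm (B n) ^+ 2 / enorm (t n))) 2) => //.
  - by move=> n; exact: measurable_subr_coord.
  - move=> n; rewrite mulr_ge0//; first by rewrite mulr_ge0// addr_ge0.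
    by rewrite divr_ge0 ?enorm_ge0// mulr_ge0 ?sqr_ge0// (opnorm_ge0 _ (t0 n)).
  - rewrite -[X in _ --> X](mulr0 (12 * (2 + C))).
    by apply: cvgM => //; exact: cvg_cst.
  - by move=> n w; exact: linearization_error.
split=> // sphZ gram.
pose A n := Gam n *m tanp (mu n) *m B n.
have AA n : A n *m (A n)^T = tanp (mu n).
  by rewrite -gram /A !trmx_mul trmx_tanp !mulmxA.
(* Along an ultrafilter the bounded matrices [A n] and vectors [mu n] converge,
   although the sequences themselves need not. *)
have limit (g : 'cV[R]_s -> R) (c : R) : continuous g -> Defs.bounded_fun g ->
    (forall (U : set_system nat) (A0 : 'M[R]_s) (mu0 : 'cV[R]_s), UltraFilter U ->
      \oo `<=` U -> mu @ U --> mu0 -> enorm mu0 = 1 -> A0 *m A0^T = tanp mu0 ->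
      Rintegral P' setT (fun w => g (A0 *m Z w)) = c) ->
    (fun n => Rintegral P setT (fun w => g (rhs n w))) @ \oo --> c /\
    (fun n => Rintegral P setT (fun w => g (lhs n w))) @ \oo --> c.
  move=> gc gb gA.
  (* Each ultrafilter has its own [A0]; the assumption on [g] says that they all give the same value
     [c]. *)
  suff H (U : set_system nat) : UltraFilter U -> \oo `<=` U ->
      (fun n => Rintegral P setT (fun w => g (rhs n w))) @ U --> c /\
      (fun n => Rintegral P setT (fun w => g (lhs n w))) @ U --> c.
    by split; apply: cvg_ultra => U UU oU; have [] := H U UU oU.
  move=> UU oU.
  have [A0 [mu0 [AU muU mu01 AA0]]] := tangent_gram_ultralimit UU mu1 AA.
  rewrite -(gA U A0 mu0)//.
  have rhsU : cvg_dist_along U P rhs P' (fun w => A0 *m Z w).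
    apply: (@cvg_dist_mulmx _ _ _ _ _ _ _ _ _ _ Zn Z A) => // f fc fb S fS.
    by apply: oU; exact: ZZ' fc fb _ fS.
  split; first exact: rhsU.
  apply: (slutsky _ mlhs mrhs _ rhsU) => //.
    exact: measurable_mulmx_coord.
  by move=> e e0 S eS; apply: oU; exact: lhs_rhs e e0 _ eS.
split=> [mu0 mu01 mumu0|].
  suff H f : continuous f -> Defs.bounded_fun f ->
      (fun n => Rintegral P setT (fun w => f (rhs n w))) @ \oo -->
        Rintegral P' setT (fun w => f (tanp mu0 *m Z w)) /\
      (fun n => Rintegral P setT (fun w => f (lhs n w))) @ \oo -->
        Rintegral P' setT (fun w => f (tanp mu0 *m Z w)).
    by split=> f fc fb; have [] := H f fc fb.
  move=> fc fb; apply: limit => // U A0 mu2 UU oU muU mu21 AA0.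
  (* Convergence of [mu] pins down its ultralimit. [A0] may still vary with [U], but its Gram matrix
     is now fixed. *)
  have <- : mu2 = mu0.
    apply/eqP; rewrite -subr_eq0 -enorm_eq0; apply/eqP.
    have h1 : (fun n => enorm (mu n - mu0)) @ U --> enorm (mu2 - mu0).
      apply: (@cvg_comp _ _ _ (fun n => mu n - mu0) (@enorm R s)); last first.
        exact: (@continuous_enorm R s (mu2 - mu0)).
      by apply: cvgB => //; exact: cvg_cst.
    have h2 : (fun n => enorm (mu n - mu0)) @ U --> (0 : R).
      by move=> S S0; apply: oU; exact: mumu0.
    exact: (@cvg_unique _ (@Rhausdorff R) _ _ _ _ h1 h2).
  exact: spherical_gram.
(* In dimension 0 every vector would be 0, against [t0]. *)
have s0 : (0 < s)%N.
  have [i _] : exists i : 'I_s, true.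
    apply: contrapT => nI; move: (t0 0%N) => /eqP; apply; apply/matrixP => i.
    by case: nI; exists i.
  exact: leq_ltn_trans (leq0n i) (ltn_ord i).
have [nu nu1 nuE] := sqr_enorm_tanp_last R s0.
have GT n : (G n)^T = G n.
  by rewrite /G linearD/= !linearZ/= (linearB _ 1%:M (tanp (mu n)))/= trmx1
    trmx_tanp.
have quadE n w : ((mut n w - mu n)^T *m G n *m (Gam n)^T *m Gam n *m G n
    *m (mut n w - mu n)) 0 0 = enorm (lhs n w) ^+ 2.
  by rewrite sqr_enorm dotcE /lhs !trmx_mul GT !mulmxA.
rewrite [X in cvg_dist P X](_ : _ = fun n w => enorm (lhs n w) ^+ 2); last first.
  by apply/funext => n; apply/funext => w; exact: quadE.
rewrite [X in cvg_dist P _ P' X](_ : _ = fun w => enorm (tanp nu *m Z w) ^+ 2);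
  last by apply/funext => w; rewrite nuE.
move=> f fc fb.
(* The test function sees only the squared norm, so the reference vector [nu] can replace the
   ultralimit of [mu], which here depends on the ultrafilter. *)
have [|||_ lhsE] := limit (fun z => f (enorm z ^+ 2))
  (Rintegral P' setT (fun w => f (enorm (tanp nu *m Z w) ^+ 2))) => //.
- by move=> z; exact: continuous_comp (@continuous_sqr_enorm R s z) (fc _).
- by have [M fM] := fb; exists M.
- move=> U A0 mu0 _ _ _ mu01 AA0.
  rewrite -(spherical_sqr_tanp sphZ mu01 nu1 fc fb).
  apply: (spherical_gram sphZ mu01 AA0 (f := fun z => f (enorm z ^+ 2))).
    by move=> z; exact: continuous_comp (@continuous_sqr_enorm R s z) (fc _).
  by have [M fM] := fb; exists M.

Qed.
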